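(* Let $G$ be a simple connected undirected graph with $n$ vertices, and let $\rho_1(G),\dots,\rho_n(G)$ be the eigenvalues, counted with multiplicity, of its resistance distance matrix. Then $$\mathcal{K}f(G)\le\frac{\sqrt{n(n-1)\sum_{i=1}^n\rho_i(G)^2}}{2}.$$
   Context: For a connected graph $G$ with vertices $v_1,\dots,v_n$, Laplacian matrix $L$ (degree matrix minus adjacency matrix) and Moore-Penrose inverse $L^\dagger=(l^\dagger_{ij})$, the resistance distance is $r_{ij}=l^\dagger_{ii}+l^\dagger_{jj}-2l^\dagger_{ij}$, and the resistance distance matrix is $R(G)=(r_{ij})_{n\times n}$. The Kirchhoff index is $\mathcal{K}f(G)=\sum_{i<j}r_{ij}$. *)

(* Defs.v *)
From mathcomp Require Import all_boot all_order all_algebra.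
From mathcomp Require Import complex.

Set Implicit Arguments.
Unset Strict Implicit.
Unset Printing Implicit Defensive.

Import Order.TTheory GRing.Theory Num.Theory.
Local Open Scope ring_scope.

(* The Moore-Penrose inverse of a real matrix is the unique solution X of the
   four Penrose equations. *)
Definition penrose (R : realFieldType) (m n : nat)
    (A : 'M[R]_(m, n)) (X : 'M[R]_(n, m)) : bool :=
  [&& A *m X *m A == A, X *m A *m X == X,
      (A *m X)^T == A *m X & (X *m A)^T == X *m A].

Lemma gram_unit (R : realFieldType) (m n : nat) (B : 'M[R]_(m, n)) :
  row_free B -> B *m B^T \in unitmx.
Proof.
move=> fB; rewrite -row_free_unit -kermx_eq0; apply/eqP/row_matrixP => i.
rewrite row0; set u := row i _.
have u0 : u *m (B *m B^T) = 0.
  by rewrite /u -row_mul mulmx_ker row0.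
have v0 : (u *m B) *m (u *m B)^T = 0.
  by rewrite trmx_mul mulmxA -(mulmxA u) u0 mul0mx.
suff : u *m B = 0 by move/eqP; rewrite mulmx_free_eq0 // => /eqP.
apply/rowP => j; move/matrixP/(_ 0 0): v0; rewrite !mxE => s0.
have := psumr_eq0P _ s0.
move=> /(_ _ j isT); rewrite [X in X * _]mxE [X in _ * X]mxE !mxE.
rewrite -expr2 => H; apply/eqP; rewrite -sqrf_eq0; apply/eqP; apply: H.
by move=> k _; rewrite !mxE -expr2 sqr_ge0.
Qed.

Lemma penrose_full_rank (R : realFieldType) (m r n : nat)
    (B : 'M[R]_(m, r)) (C : 'M[R]_(r, n)) :
  row_free B^T -> row_free C ->
  penrose (B *m C) (C^T *m invmx (C *m C^T) *m invmx (B^T *m B) *m B^T).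
Proof.
move=> fB /gram_unit uC.
have uB : B^T *m B \in unitmx by rewrite -[X in _ *m X]trmxK gram_unit.
set VC := invmx (C *m C^T); set VB := invmx (B^T *m B).
have sC : VC^T = VC by rewrite /VC trmx_inv trmx_mul trmxK.
have sB : VB^T = VB by rewrite /VB trmx_inv trmx_mul trmxK.
have CX : C *m (C^T *m VC *m VB *m B^T) = VB *m B^T.
  by rewrite !mulmxA mulmxV // mul1mx.
have XB : C^T *m VC *m VB *m B^T *m B = C^T *m VC.
  by rewrite -!mulmxA mulVmx // mulmx1.
rewrite /penrose.
have -> : B *m C *m (C^T *m VC *m VB *m B^T) = B *m VB *m B^T.
  by rewrite -mulmxA CX mulmxA.
have -> : C^T *m VC *m VB *m B^T *m (B *m C) = C^T *m VC *m C.
  by rewrite mulmxA XB.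
apply/and4P; split; apply/eqP.
- by rewrite -!mulmxA (mulmxA B^T) (mulmxA VB) mulVmx // mul1mx.
- by rewrite -!mulmxA (mulmxA C) (mulmxA (C *m C^T)) mulmxV // mul1mx.
- by rewrite !trmx_mul trmxK sB mulmxA.
- by rewrite !trmx_mul trmxK sC mulmxA.
Qed.

Lemma penrose_exists (R : realFieldType) (m n : nat) (A : 'M[R]_(m, n)) :
  exists X, penrose A X.
Proof.
have := @penrose_full_rank R m _ n (col_base A) (row_base A).
rewrite mulmx_base => H; eexists; apply: H; last exact: row_base_free.
by rewrite /row_free mxrank_tr; exact: col_base_full.
Qed.

Lemma penrose_unique (R : realFieldType) (m n : nat) (A : 'M[R]_(m, n))
    (X Y : 'M[R]_(n, m)) : penrose A X -> penrose A Y -> X = Y.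
Proof.
move=> /and4P[/eqP x1 /eqP x2 /eqP x3 /eqP x4].
move=> /and4P[/eqP y1 /eqP y2 /eqP y3 /eqP y4].
have e1 : A *m X = A *m Y.
  have : ((A *m X) *m (A *m Y))^T = A *m Y by rewrite mulmxA x1 y3.
  by rewrite trmx_mul x3 y3 mulmxA y1.
have e2 : X *m A = Y *m A.
  have : ((Y *m A) *m (X *m A))^T = Y *m A by rewrite -mulmxA (mulmxA A) x1 y4.
  by rewrite trmx_mul x4 y4 -mulmxA (mulmxA A) y1.
by rewrite -x2 e2 -mulmxA e1 mulmxA y2.
Qed.

Definition moore_penrose (R : realFieldType) (m n : nat) (A : 'M[R]_(m, n)) :
  'M[R]_(n, m) := xchoose (penrose_exists A).

Lemma moore_penroseP (R : realFieldType) (m n : nat) (A : 'M[R]_(m, n)) :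
  penrose A (moore_penrose A).
Proof. exact: xchooseP. Qed.

Record sgraph (n : nat) := SGraph {
  adj :> rel 'I_n;
  adj_sym : symmetric adj;
  adj_irr : irreflexive adj
}.

Definition connected_graph (n : nat) (G : sgraph n) : bool :=
  (0 < n)%N && [forall i, forall j, connect G i j].

Definition degree (n : nat) (G : sgraph n) (i : 'I_n) : nat :=
  #|[set j | G i j]|.

Definition adjacency_mx (R : realFieldType) (n : nat) (G : sgraph n) :
  'M[R]_n := \matrix_(i, j) (G i j)%:R.

Definition laplacian (R : realFieldType) (n : nat) (G : sgraph n) : 'M[R]_n :=
  diag_mx (\row_i (degree G i)%:R) - adjacency_mx R G.

Definition resistance_mx (R : realFieldType) (n : nat) (G : sgraph n) :
    'M[R]_n :=
  let Ld := moore_penrose (laplacian R G) in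
  \matrix_(i, j) (Ld i i + Ld j j - 2 * Ld i j).

Definition kirchhoff_index (R : realFieldType) (n : nat) (G : sgraph n) : R :=
  \sum_(i < n) \sum_(j < n | (i < j)%N) resistance_mx R G i j.

(* The family rho runs over the roots of the characteristic polynomial of A,
   each repeated according to its multiplicity. For symmetric A over a real
   closed field such a rho exists (symmetric_eigenvalues) and is unique up to
   reindexing. *)
Definition eigenvalue_list (R : realFieldType) (n : nat) (A : 'M[R]_n)
    (rho : 'I_n -> R) : Prop :=
  char_poly A = \prod_(i < n) ('X - (rho i)%:P).

Lemma char_poly_conj (F : fieldType) (n : nat) (P D : 'M[F]_n) :
  P \in unitmx -> char_poly (invmx P *m D *m P) = char_poly D.
Proof.
move=> uP; rewrite /char_poly /char_poly_mx.
have uP' : map_mx polyC (invmx P) *m map_mx polyC P = 1%:M.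
  by rewrite -map_mxM mulVmx // map_mx1.
rewrite -[X in X - _]mulmx1 -uP' mulmxA -scalar_mxC !map_mxM /=.
rewrite -mulmxBl -mulmxBr !det_mulmx mulrC mulrA -det_mulmx.
by rewrite (mulmx1C uP') det1 mul1r.
Qed.

Lemma symmetric_eigenvalues (R : rcfType) (n : nat) (A : 'M[R]_n) :
  A^T = A -> exists rho, eigenvalue_list A rho.
Proof.
move=> sA; pose f := real_complex R; pose B := map_mx f A.
have rB : B \is a realmx by apply/mxOverP => i j; rewrite mxE complex_real.
have hB : B \is hermsymmx.
  apply: realsym_hermsym => //.
  by apply/is_hermitianmxP; rewrite expr0 scale1r map_mx_id // map_trmx sA.
have /mxOverP dR := hermitian_spectral_diag_real hB.
have /orthomx_spectralP BE := hermitian_normalmx hB.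
exists (fun i => complex.Re (spectral_diag B 0 i)).
apply: (map_inj_poly (fmorph_inj f) (rmorph0 f)).
rewrite map_char_poly -/B [in LHS]BE char_poly_conj ?spectral_unit //.
rewrite char_poly_trig ?diag_mx_is_trig // rmorph_prod.
apply: eq_bigr => i _; rewrite mxE eqxx mulr1n rmorphB /= map_polyX map_polyC /=.
by congr ('X - _%:P); apply: esym; exact: RRe_real (dR 0 i).
Qed.

Lemma moore_penrose_sym (R : realFieldType) (n : nat) (A : 'M[R]_n) :
  A^T = A -> (moore_penrose A)^T = moore_penrose A.
Proof.
move=> sA; have /and4P[/eqP x1 /eqP x2 /eqP x3 /eqP x4] := moore_penroseP A.
apply: (@penrose_unique _ _ _ A); last exact: moore_penroseP.
set X := moore_penrose A in x1 x2 x3 x4 *.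
have AX : A *m X^T = X *m A by rewrite -x4 trmx_mul sA.
have XA : X^T *m A = A *m X by rewrite -x3 trmx_mul sA.
apply/and4P; split; apply/eqP.
- by have := congr1 trmx x1; rewrite !trmx_mul sA mulmxA => ->.
- by have := congr1 trmx x2; rewrite !trmx_mul sA mulmxA => ->.
- by rewrite AX x4.
- by rewrite XA x3.
Qed.

Lemma resistance_mx_sym (R : realFieldType) (n : nat) (G : sgraph n) :
  (resistance_mx R G)^T = resistance_mx R G.
Proof.
have sL : (laplacian R G)^T = laplacian R G.
  rewrite /laplacian raddfB /= tr_diag_mx; congr (_ - _).
  by apply/matrixP => i j; rewrite !mxE adj_sym.
have sLd := moore_penrose_sym sL; apply/matrixP => i j; rewrite !mxE.
by rewrite -[in LHS]sLd !mxE (addrC (moore_penrose _ j j)).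
Qed.

Lemma resistance_eigenvalues (R : rcfType) (n : nat) (G : sgraph n) :
  exists rho, eigenvalue_list (resistance_mx R G) rho.
Proof. exact/symmetric_eigenvalues/resistance_mx_sym. Qed.

(* Main.v *)
Require Import Defs.
From mathcomp Require Import all_boot all_order all_algebra.
From mathcomp Require Import ring lra.
Import Order.TTheory GRing.Theory Num.Theory.
Local Open Scope ring_scope.

(** The resistance matrix A = (r_ij) is symmetric with zero diagonal, so twice
    the Kirchhoff index is the sum of its n (n - 1) off-diagonal entries. By
    the Cauchy-Schwarz inequality (lemma [sqr_sum_le]) the square of that sum
    is at most n (n - 1) times the sum of the r_ij ^ 2, which is tr (A A) by
    symmetry. Finally tr (A A) is the sum of the squared eigenvalues (lemma
    [mxtrace_sqr_eigenvalues]): replacing X by X ^ 2 in the characteristic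
    polynomial of A A gives
    det (X^2 - A A) = det (X - A) det (X + A) = prod_i (X^2 - rho_i ^ 2),
    so the rho_i ^ 2 are the eigenvalues of A A and their sum is its trace. *)

Lemma comp_polyX2_inj (R : comNzRingType) :
  injective (fun p : {poly R} => p \Po 'X^2).
Proof.
move=> p q /= /polyP epq; apply/polyP => i.
have := epq (i * 2)%N.
by rewrite !coef_comp_poly_Xn // !dvdn_mull // !mulnK.
Qed.

(** det (X + A), computed from det (X - A) by substituting - X for X. *)
Lemma det_polyX_add (R : comNzRingType) (n : nat) (A : 'M[R]_n)
    (rho : 'I_n -> R) :
  char_poly A = \prod_(i < n) ('X - (rho i)%:P) ->
  \det ('X%:M + map_mx polyC A) = \prod_(i < n) ('X + (rho i)%:P).
Proof.
move=> eA.
have -> : 'X%:M + map_mx polyC A =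
    - map_mx (comp_poly (- 'X)) (char_poly_mx A).
  apply/matrixP => i j.
  by rewrite !mxE raddfB raddfMn /= comp_polyX comp_polyC opprB mulNrn opprK
             addrC.
rewrite -scaleN1r detZ det_map_mx -/(char_poly A) eA rmorph_prod /=.
rewrite -[n in _ ^+ n]card_ord -prodr_const -big_split /=.
apply: eq_bigr => i _.
by rewrite raddfB /= comp_polyX comp_polyC mulN1r opprB opprK addrC.
Qed.

Lemma char_poly_sqr (R : comNzRingType) (n : nat) (A : 'M[R]_n)
    (rho : 'I_n -> R) :
  char_poly A = \prod_(i < n) ('X - (rho i)%:P) ->
  char_poly (A *m A) = \prod_(i < n) ('X - (rho i ^+ 2)%:P).
Proof.
move=> eA; apply: comp_polyX2_inj => /=.
rewrite -det_map_mx.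
have -> : map_mx (comp_poly 'X^2) (char_poly_mx (A *m A)) =
    char_poly_mx A *m ('X%:M + map_mx polyC A).
  rewrite /char_poly_mx mulmxBl !mulmxDr (scalar_mxC 'X (map_mx polyC A)).
  rewrite -scalar_mxM -map_mxM.
  rewrite opprD addrA addrK -expr2.
  apply/matrixP => i j; rewrite [LHS]mxE [RHS]mxE !mxE.
  by rewrite raddfB raddfMn /= comp_polyX comp_polyC.
rewrite det_mulmx -/(char_poly A) eA (det_polyX_add _ _ _ _ eA) -big_split /=.
rewrite rmorph_prod /=; apply: eq_bigr => i _.
by rewrite raddfB /= comp_polyX comp_polyC rmorphXn /= -subr_sqr.
Qed.

Lemma mxtrace_sqr_eigenvalues (R : comNzRingType) (n : nat) (A : 'M[R]_n)
    (rho : 'I_n -> R) :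
  char_poly A = \prod_(i < n) ('X - (rho i)%:P) ->
  \tr (A *m A) = \sum_(i < n) rho i ^+ 2.
Proof.
case: n A rho => [|n] A rho eA; first by rewrite /mxtrace !big_ord0.
have := char_poly_trace (A *m A) (ltn0Sn n).
rewrite (char_poly_sqr _ _ _ _ eA) /= => coef_tr.
have := @coefPn_prod_XsubC R [seq rho i ^+ 2 | i : 'I_n.+1].
rewrite size_map -cardE card_ord big_image /= => /(_ isT).
by rewrite big_image /= coef_tr => /oppr_inj.
Qed.

(** The Cauchy-Schwarz inequality against the constant family 1: the difference
    of the two sides is half of the sum of all (F i - F j) ^ 2. *)
Lemma sqr_sum_le (R : realDomainType) (I : finType) (P : pred I) (F : I -> R) :
  (\sum_(i | P i) F i) ^+ 2 <= #|P|%:R * \sum_(i | P i) F i ^+ 2.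
Proof.
set S := \sum_(i | P i) F i; set Q := \sum_(i | P i) F i ^+ 2.
have : 0 <= \sum_(i | P i) \sum_(j | P j) (F i - F j) ^+ 2.
  by do 2!apply: sumr_ge0 => ? _; exact: sqr_ge0.
have -> : \sum_(i | P i) \sum_(j | P j) (F i - F j) ^+ 2 =
    \sum_(i | P i) (F i ^+ 2 * #|P|%:R - F i * S *+ 2 + Q).
  apply: eq_bigr => i _.
  under eq_bigr do rewrite sqrrB.
  rewrite big_split sumrB /= sumr_const sumrMnl -mulr_sumr -(mulr_natr (F i ^+ 2)).
  by [].
rewrite big_split sumrB /= sumr_const -mulr_suml -(mulr_natr Q).
rewrite sumrMnl -mulr_suml -/S -/Q.
lra.
Qed.

Lemma card_off_diagonal (n : nat) :
  #|[pred p : 'I_n * 'I_n | p.1 != p.2]| = (n * n.-1)%N.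
Proof.
rewrite -sum1_card -(pair_big_dep xpredT (fun i j : 'I_n => i != j)
  (fun _ _ => 1%N)) /=.
rewrite (eq_bigr (fun=> n.-1)) => [|i _].
  by rewrite sum_nat_const card_ord.
rewrite sum1_card -[in RHS](card_ord n) -(cardC1 i).
by apply: eq_card => j; rewrite !inE eq_sym.
Qed.

Lemma sum_off_diagonal (V : nmodType) (n : nat) (F : 'I_n -> 'I_n -> V) :
  (forall i j, F i j = F j i) ->
  \sum_(i < n) \sum_(j < n | i != j) F i j =
    (\sum_(i < n) \sum_(j < n | (i < j)%N) F i j) *+ 2.
Proof.
move=> sF; rewrite mulr2n.
rewrite [X in _ = _ + X](exchange_big_dep xpredT) //= -big_split /=.
apply: eq_bigr => i _; rewrite (bigID (fun j : 'I_n => (i < j)%N)) /=.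
congr (_ + _); first by apply: eq_bigl => j; rewrite -val_eqE /=; case: ltngtP.
by apply: eq_big => [j|j _]; [rewrite -val_eqE /=; case: ltngtP | exact: sF].
Qed.

Theorem theorem5p4 (R : rcfType) (n : nat) (G : sgraph n)
    (rho : 'I_n -> R)
    (conG : connected_graph G)
    (eig : eigenvalue_list (resistance_mx R G) rho) :
  kirchhoff_index R G <=
    Num.sqrt (n%:R * (n%:R - 1) * \sum_(i < n) rho i ^+ 2) / 2.
Proof.
rewrite -(mxtrace_sqr_eigenvalues _ _ _ _ eig).
have symA i j : resistance_mx R G i j = resistance_mx R G j i.
  by rewrite -[in LHS]resistance_mx_sym mxE.
have diagA i : resistance_mx R G i i = 0 by rewrite mxE; ring.
rewrite ler_pdivlMr // mulr_natr /kirchhoff_index -sum_off_diagonal //.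
move: (resistance_mx R G) symA diagA => A symA diagA.
have -> : \tr (A *m A) = \sum_(i < n) \sum_(j < n | i != j) A i j ^+ 2.
  apply: eq_bigr => i _; rewrite mxE (bigD1 i) //= diagA mul0r add0r.
  by apply: eq_big => [j|j _]; [rewrite eq_sym | rewrite (symA j)].
rewrite !pair_big_dep /=.
have := sqr_sum_le _ _ [pred p : 'I_n * 'I_n | p.1 != p.2] (fun p => A p.1 p.2).
rewrite card_off_diagonal natrM.
have -> : n%:R * n.-1%:R = n%:R * (n%:R - 1) :> R.
  by case: (n) => [|m]; [rewrite !mul0r | rewrite -natr1 addrK].
move/ler_wsqrtr; rewrite sqrtr_sqr; apply: le_trans; exact: ler_norm.
Qed.
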